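(* Let $n\ge 3$ and $2\le d\le n-1$ be integers, and let $P_n$ be the path on $n$ vertices. Then $$\mathrm{gp}_d(P_n)=\begin{cases} 2\left\lceil\frac{n}{d+1}\right\rceil-1, & n\equiv 1 \pmod{d+1},\\[0.2cm] 2\left\lceil\frac{n}{d+1}\right\rceil, & \text{otherwise.}\end{cases}$$
   Context: $d_G(u,w)$ denotes the shortest-path distance in a connected graph $G$, and $I_G(u,w)=\{x\in V(G): d_G(u,w)=d_G(u,x)+d_G(x,w)\}$. A set $S\subseteq V(G)$ is a general $d$-position set if for any three distinct vertices $u,v,w\in S$ with $v\in I_G(u,w)$ we have $d_G(u,w)>d$. $\mathrm{gp}_d(G)$ is the cardinality of a largest general $d$-position set of $G$. *)

(* Defs.v *)
From HB Require Import structures.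
From mathcomp Require Import all_boot all_order all_algebra.

Set Implicit Arguments.
Unset Strict Implicit.
Unset Printing Implicit Defensive.

Record sgraph := SGraph {
  vertex :> finType;
  edge : rel vertex;
  edge_sym : symmetric edge;
  edge_irrefl : irreflexive edge }.

Definition connected_graph (G : sgraph) : Prop :=
  forall u w : G, connect (@edge G) u w.

Definition has_walk (G : sgraph) (u w : G) (k : nat) : bool :=
  [exists p : k.-tuple G, path (@edge G) u p && (last u p == w)].

(* The least length of a walk from u to w.  A shortest walk repeats no vertex,
   so lengths below #|G| suffice; if u and w are not connected, the value is
   the junk value #|G|. *)
Definition gdist (G : sgraph) (u w : G) : nat :=
  find (has_walk u w) (iota 0 #|G|).

Definition interval (G : sgraph) (u w : G) : {set G} :=
  [set x | gdist u w == gdist u x + gdist x w].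

Definition general_position (G : sgraph) (d : nat) (S : {set G}) : bool :=
  [forall u in S, forall v in S, forall w in S,
    uniq [:: u; v; w] && (v \in interval u w) ==> (d < gdist u w)].

Definition gp (d : nat) (G : sgraph) : nat :=
  \max_(S : {set G} | general_position d S) #|S|.

Definition path_edge (n : nat) : rel 'I_n :=
  fun i j => (i.+1 == j :> nat) || (j.+1 == i :> nat).

Fact path_edge_sym n : symmetric (@path_edge n).
Proof. by move=> i j; rewrite /path_edge orbC. Qed.

Fact path_edge_irrefl n : irreflexive (@path_edge n).
Proof. by move=> i; rewrite /path_edge orbb -[X in _ == X]add0n -add1n eqn_add2r. Qed.

Definition path_graph (n : nat) : sgraph :=
  SGraph (@path_edge_sym n) (@path_edge_irrefl n).

Fact path_graph_connected n : connected_graph (path_graph n).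
Proof.
have up k (i j : 'I_n) : i + k = j -> connect (@path_edge n) i j.
  elim: k j => [|k IHk] j; first by rewrite addn0 => /val_inj ->.
  rewrite addnS => ij; have lt_ik : i + k < n by rewrite ltnW // ij ltn_ord.
  apply: (connect_trans (IHk (Ordinal lt_ik) erefl)).
  by apply: connect1; rewrite /path_edge /= ij eqxx.
move=> i j; case/orP: (leq_total i j) => le_ij.
  exact: up (subnKC le_ij).
rewrite (sym_connect_sym (@edge_sym (path_graph n))).
exact: up (subnKC le_ij).
Qed.

(* Main.v *)
Require Import Defs.
From HB Require Import structures.
From mathcomp Require Import all_boot all_order all_algebra.
From mathcomp Require Import zify.
Import Order.TTheory GRing.Theory Num.Theory.

(** Distances in a path are differences of labels, so a set S of vertices is in
    general d-position exactly when u < v < w in S forces w - u >= d + 1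
    ([general_position_path]).  If s_0 < s_1 < ... lists such a set, this says
    that s_(k+2) >= s_k + (d + 1) for every k.  With s_0 >= 0 and s_1 >= 1, the
    slowest growing list allowed is

      0, 1, (d+1), (d+1) + 1, 2(d+1), 2(d+1) + 1, ...

    whose k-th term is [paired d.+1 k].  This one sequence gives both bounds.
    It is a lower bound for every sorted list in general position
    ([paired_le_spread]), so a set with more than N elements has a vertex with
    label at least [paired d.+1 N], which is impossible once that value reaches
    n.  Conversely its initial segments are themselves in general position
    ([general_position_path_paired]).  Hence gp_d(P_n) is the number of terms
    below n ([gp_path_paired]).  Writing n = q (d+1) + r with r <= d, that
    number is 2q + min(2, r) ([gp_path]): two terms in each complete block of
    length d + 1, and as many of the next pair as fit.  The ceiling of n/(d+1)
    is q for r = 0 and q + 1 otherwise, so 2q + min(2, r) is twice the ceiling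
    except when r = 1, where it is one less. *)

(** The bound by the order of the graph is there because [gdist] only searches
    lengths below it. *)
Lemma gdist_least (G : sgraph) (u w : G) (k : nat) :
  k < #|G| -> has_walk u w k -> (forall l, has_walk u w l -> k <= l) ->
  gdist u w = k.
Proof.
move=> lt_kG walk_k min_k; rewrite /gdist.
have hasw : has (has_walk u w) (iota 0 #|G|).
  by apply/hasP; exists k => //; rewrite mem_iota.
have find_lt := hasw; rewrite has_find size_iota in find_lt.
apply/eqP; rewrite eqn_leq; apply/andP; split.
  rewrite leqNgt; apply/negP => /(before_find 0).
  by rewrite nth_iota // add0n walk_k.
by apply: min_k; move: (nth_find 0 hasw); rewrite nth_iota.
Qed.

(** Each step changes the label by one.  In truncated subtraction,
    (i - j) + (j - i) is the absolute difference of i and j. *)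
Lemma path_walk_length (n : nat) (i : 'I_n) (p : seq 'I_n) :
  path (@path_edge n) i p -> (i - last i p) + (last i p - i) <= size p.
Proof.
elim: p i => [|j p IHp] i /=; first by lia.
by case/andP=> /orP[] /eqP eij /IHp; lia.
Qed.

Lemma path_has_walk_up (n : nat) (i j : path_graph n) :
  i <= j -> has_walk i j (j - i).
Proof.
move Dk : (j - i) => k; elim: k i Dk => [|k IHk] i Dk le_ij.
  apply/existsP; exists [tuple] => /=; apply/eqP/val_inj => /=; lia.
have lt_in : i.+1 < n by have := ltn_ord j; lia.
have /existsP[p /andP[p_path p_last]] : has_walk (Ordinal lt_in : path_graph n) j k.
  by apply: IHk => /=; lia.
apply/existsP; exists [tuple of (Ordinal lt_in : path_graph n) :: p] => /=.
by rewrite {1}/path_edge /= eqxx /= p_path.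
Qed.

Lemma has_walk_sym (G : sgraph) (u w : G) (k : nat) :
  has_walk u w k -> has_walk w u k.
Proof.
case/existsP=> p /andP[p_path /eqP <-].
have sz : size (rev (belast u p)) == k by rewrite size_rev size_belast size_tuple.
apply/existsP; exists (Tuple sz); rewrite /= rev_path.
rewrite (eq_path (e' := @edge G)) ?p_path => [|x y]; last by rewrite edge_sym.
by case: (tval p) => [|x s] //=;
  rewrite rev_cons last_rcons eqxx.
Qed.

Lemma gdist_path (n : nat) (i j : path_graph n) :
  gdist i j = (i - j) + (j - i).
Proof.
apply: gdist_least.
- by rewrite card_ord; have := ltn_ord i; have := ltn_ord j; lia.
- case: (leqP i j) => [le_ij | /ltnW le_ji].
    have -> : (i - j) + (j - i) = j - i by lia.
    exact: path_has_walk_up.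
  have -> : (i - j) + (j - i) = i - j by lia.
  by apply: has_walk_sym; apply: path_has_walk_up.
- move=> l /existsP[p /andP[/path_walk_length + /eqP p_last]].
  by rewrite p_last size_tuple.
Qed.

(** On a line the interval between two vertices consists of the labels between
    theirs, and the definition is symmetric in its two endpoints, so only
    increasing triples constrain S. *)
Lemma general_position_path (n d : nat) (S : {set path_graph n}) :
  reflect (forall u v w, u \in S -> v \in S -> w \in S ->
             u < v -> v < w -> u + d.+1 <= w)
          (general_position d S).
Proof.
apply: (iffP idP) => [posS u v w Su Sv Sw lt_uv lt_vw | spreadS].
  move/forall_inP: posS => /(_ u Su) /forall_inP/(_ v Sv) /forall_inP/(_ w Sw).
  rewrite /= !inE !gdist_path -!val_eqE /= => /implyP; lia.
apply/forall_inP=> u Su; apply/forall_inP=> v Sv; apply/forall_inP=> w Sw.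
apply/implyP; rewrite /= !inE !gdist_path -!val_eqE /= => uvw.
case: (ltngtP u v) => [lt_uv | lt_vu | eq_uv]; last by lia.
- by have := spreadS u v w Su Sv Sw lt_uv; lia.
- by have := spreadS w v u Sw Sv Su; lia.
Qed.

(** The sequence 0, 1, m, m + 1, 2m, 2m + 1, ..., indexed from 0. *)
Definition paired (m k : nat) : nat := k./2 * m + odd k.

Lemma paired_step2 (m k : nat) : paired m k.+2 = paired m k + m.
Proof. by rewrite /paired /= negbK mulSn; lia. Qed.

Lemma paired_double (m q : nat) : paired m q.*2 = q * m.
Proof. by rewrite /paired doubleK odd_double addn0. Qed.

Lemma paired_doubleS (m q : nat) : paired m q.*2.+1 = q * m + 1.
Proof. by rewrite /paired /= uphalf_double odd_double. Qed.

Lemma paired_mono (m : nat) : 1 < m -> {mono paired m : i j / i <= j}.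
Proof.
move=> m_gt1; apply: leq_mono; apply: homo_ltn => [|k].
- exact: ltn_trans.
- by rewrite /paired /= uphalf_half; case: (odd k) => /=; lia.
Qed.

(** Induction in steps of two.  The base cases are s_0 >= 0 and s_1 >= 1, the
    latter because s_1 > s_0. *)
Lemma paired_le_spread (m : nat) (s : seq nat) :
  sorted ltn s ->
  (forall k, k.+2 < size s -> nth 0 s k + m <= nth 0 s k.+2) ->
  forall k, k < size s -> paired m k <= nth 0 s k.
Proof.
move=> s_incr s_spread k.
elim/ltn_ind: k => [[|[|k]]] IHk lt_ks //.
- have := sorted_ltn_nth ltn_trans 0 s_incr 0 1 (ltnW lt_ks) lt_ks isT.
  exact: leq_ltn_trans.
- rewrite paired_step2; apply: leq_trans (s_spread k lt_ks).
  by rewrite leq_add2r IHk // ltnW // ltnW.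
Qed.

(** With more than N elements, the sorted list of S has an entry of index N,
    which is at least [paired d.+1 N >= n] and so is not a vertex. *)
Lemma general_position_path_card (n d N : nat) (S : {set path_graph n}) :
  n <= paired d.+1 N -> general_position d S -> #|S| <= N.
Proof.
move=> le_n /general_position_path spreadS; rewrite leqNgt; apply/negP => lt_NS.
pose s := [seq val i | i <- enum S].
have size_s : size s = #|S| by rewrite size_map -cardE.
have s_incr : sorted ltn s.
  rewrite sorted_map /enum_mem; apply: sorted_filter.
    by move=> ? ? ?; apply: ltn_trans.
  by rewrite -enumT -sorted_map val_enum_ord iota_ltn_sorted.
have s_in k : k < size s -> exists2 i : path_graph n, i \in S & nth 0 s k = i.
  by move=> /(mem_nth 0)/mapP[i iS ->]; exists i; rewrite // -mem_enum.
have s_lt k l : k < l -> l < size s -> nth 0 s k < nth 0 s l.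
  move=> lt_kl lt_ls; apply: (sorted_ltn_nth ltn_trans 0 s_incr) => //.
  exact: ltn_trans lt_ls.
have s_spread k : k.+2 < size s -> nth 0 s k + d.+1 <= nth 0 s k.+2.
  move=> k_lt; have lt01 := s_lt k k.+1 (leqnn _) (ltnW k_lt).
  have lt12 := s_lt k.+1 k.+2 (leqnn _) k_lt.
  have [u Su eu] := s_in k (ltnW (ltnW k_lt)).
  have [v Sv ev] := s_in k.+1 (ltnW k_lt); have [w Sw ew] := s_in k.+2 k_lt.
  by move: lt01 lt12; rewrite eu ev ew; apply: spreadS.
rewrite -size_s in lt_NS; have [i _ ei] := s_in N lt_NS.
have := paired_le_spread _ s s_incr s_spread N lt_NS.
by rewrite ei => /(leq_trans le_n); rewrite leqNgt ltn_ord.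
Qed.

(** Two terms of the sequence whose indices differ by at least two differ by at
    least d + 1, and a triple i < j < k of indices has k >= i + 2.  Positivity
    of d makes the sequence strictly increasing. *)
Lemma general_position_path_paired (n d N : nat) :
  0 < d -> (forall k, k < N -> paired d.+1 k < n) ->
  exists2 S : {set path_graph n}, general_position d S & #|S| = N.
Proof.
move=> d_gt0 lt_n; have mono := paired_mono d.+1 d_gt0.
pose f (k : 'I_N) : path_graph n := Ordinal (lt_n k (ltn_ord k)).
exists (f @: 'I_N); last first.
  rewrite card_imset ?card_ord // => i j [eq_ij].
  by apply/val_inj/(incn_inj mono).
apply/general_position_path => _ _ _ /imsetP[i _ ->] /imsetP[j _ ->] /imsetP[k _ ->].
rewrite /= !(leqW_mono mono) => lt_ij lt_jk.
by rewrite -paired_step2 mono (leq_ltn_trans lt_ij).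
Qed.

Lemma gp_path_paired (n d N : nat) :
  0 < d -> n <= paired d.+1 N -> (forall k, k < N -> paired d.+1 k < n) ->
  gp d (path_graph n) = N.
Proof.
move=> d_gt0 le_n lt_n; apply/eqP; rewrite eqn_leq; apply/andP; split.
  by apply/bigmax_leqP => S; apply: general_position_path_card.
have [S posS <-] := general_position_path_paired n d N d_gt0 lt_n.
by rewrite /gp (bigD1 S) //= leq_maxl.
Qed.

Lemma gp_path (n d : nat) : 0 < d ->
  gp d (path_graph n) = (n %/ d.+1).*2 + minn 2 (n %% d.+1).
Proof.
move=> d_gt0; have mono := paired_mono d.+1 d_gt0.
have n_eq := divn_eq n d.+1; have r_lt := ltn_pmod n (ltn0Sn d).
set q := n %/ d.+1 in n_eq *; set r := n %% d.+1 in n_eq r_lt *.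
(* By monotonicity only the last index has to be compared with n. *)
have below N l : paired d.+1 l < n -> N <= l.+1 ->
    forall k, k < N -> paired d.+1 k < n.
  move=> lt_l le_N k /leq_trans/(_ le_N) le_kl.
  by apply: leq_ltn_trans lt_l; rewrite mono.
case: r n_eq r_lt => [|[|r]] n_eq r_lt; apply: gp_path_paired => //.
- by rewrite n_eq !addn0 paired_double.
- case: q n_eq => [|q] n_eq //.
  apply: (below _ q.*2.+1); rewrite ?paired_doubleS ?n_eq; lia.
- by rewrite n_eq [minn _ _]/= (addn1 q.*2) paired_doubleS.
- by apply: (below _ q.*2); rewrite ?paired_double ?n_eq; lia.
- have -> : minn 2 r.+2 = 2 by lia.
  by rewrite n_eq addn2 -doubleS paired_double; lia.
- by apply: (below _ q.*2.+1); rewrite ?paired_doubleS ?n_eq; lia.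
Qed.

Local Open Scope ring_scope.

Lemma ceil_divn (n m : nat) : (0 < m)%N ->
  Num.ceil (n%:R / m%:R : rat) = ((n %/ m) + (n %% m != 0))%N%:Z.
Proof.
move=> m_gt0; apply: ceil_def.
have m_gt0' : 0 < m%:R :> rat by rewrite ltr0n.
rewrite ltr_pdivlMr // ler_pdivrMr // !pmulrn -!intrM ltr_int ler_int.
have n_eq := divn_eq n m; have r_lt := ltn_pmod n m_gt0.
move: (n %/ m)%N (n %% m)%N n_eq r_lt => q r -> r_lt.
case: r r_lt => [|r] /= r_lt; lia.
Qed.

Theorem proposition3p1 (n d : nat) (hn : (3 <= n)%N) (hd : (2 <= d <= n - 1)%N) :
  (gp d (path_graph n))%:Z =
    if (n == 1 %[mod d.+1])%N
    then 2 * Num.ceil (n%:R / d.+1%:R : rat) - 1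
    else 2 * Num.ceil (n%:R / d.+1%:R : rat).
Proof.
have d_gt1 : (1 < d)%N by case/andP: hd.
rewrite gp_path; last exact: ltnW.
rewrite ceil_divn // [(1 %% _)%N]modn_small; last by rewrite ltnS ltnW.
by case: ifP; case: eqP; lia.
Qed.
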